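(* For every nonzero ideal $\mathfrak n$ of $A$ generated by a monic polynomial $n$, \[T_{\mathfrak n}E(z,s)=|\mathfrak n|^s\,\sigma_{1-2s}(\mathfrak n)\,E(z,s).\]
   Context: $q$ odd prime power, $A=\mathbb{F}_q[T]$, $k_\infty=\mathbb{F}_q((T^{-1}))$, $|T|=q$, $\Omega=\mathbb{C}_\infty\smallsetminus k_\infty$, $\Gamma=\mathrm{PGL}_2(A)$, $\Gamma_\infty$ its upper-triangular subgroup. $|z|_i=\min_{w\in k_\infty}|z-w|$ and $E(z,s)=\sum_{\gamma\in\Gamma_\infty\backslash\Gamma}|\gamma z|_i^s$. The Hecke operator is $T_{\mathfrak n}F(z)=\sum_{a\text{ monic},\,ad=n,\,\deg b<\deg d}F\big(\frac{az+b}{d}\big)$ for $F$ on $\Gamma\backslash\Omega$; $|\mathfrak n|=q^{\deg n}$; and $\sigma_s(\mathfrak n)=\sigma_s(n)=\sum_{m\text{ monic},\,m\mid n}|m|^s$. *)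

(* Defs.v *)
From mathcomp Require Import all_boot all_order all_algebra.
From mathcomp Require Import all_classical all_reals all_analysis.
From mathcomp Require Export complex.
Set Implicit Arguments. Unset Strict Implicit. Unset Printing Implicit Defensive.
Import Order.TTheory GRing.Theory Num.Theory.
Local Open Scope ring_scope.
Local Open Scope classical_set_scope.

(* Setting.  F = F_q (finite field, q = #|F|), A = {poly F} = F_q[T].        *)
(* C_infty is modelled by an abstract algebraically closed field K with an    *)
(* absolute value abs : K -> R and a ring embedding emb : A -> K, subject to *)
(* [is_Cinf], which characterises (K, abs) up to isometric isomorphism as the*)
(* completion of an algebraic closure of k_infty = F_q((1/T)):               *)
(*  - abs is a non-archimedean absolute value on K, with |a| = q^deg a on A; *)
(*  - K is complete;                                                          *)
(*  - k_infty is the closure in K of Frac(emb A) = F_q(T);                    *)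
(*  - the elements of K algebraic over k_infty are dense in K.                *)

Notation i0 := (@Ordinal 2 0 isT).
Notation i1 := (@Ordinal 2 1 isT).

Section Cinf.
Variables (F : finFieldType) (R : realType) (K : closedFieldType)
  (abs : K -> R) (emb : {rmorphism {poly F} -> K}).

Definition qF : R := (#|F|)%:R.

(* |a| = q^(deg a) for a in A, |0| = 0 ; this is |n| = #(A/nA) for ideals *)
Definition absA (a : {poly F}) : R := if a == 0 then 0 else qF ^+ (size a).-1.

Definition kinf : set K :=
  [set x | forall e : R, 0 < e ->
     exists a b : {poly F}, b != 0 /\ abs (x - emb a / emb b) < e].

Definition algebraic_over (S : set K) (x : K) : Prop :=
  exists p : {poly K}, p != 0 /\ (forall i, S p`_i) /\ root p x.

Definition is_Cinf : Prop :=
  (forall x, abs x = 0 <-> x = 0) /\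
  (forall x, 0 <= abs x) /\
  (forall x y, abs (x * y) = abs x * abs y) /\
  (forall x y, abs (x + y) <= Num.max (abs x) (abs y)) /\
  (forall a, abs (emb a) = absA a) /\
  (forall u : nat -> K,
     (forall e : R, 0 < e -> exists N, forall m n, (N <= m)%N -> (N <= n)%N ->
         abs (u m - u n) < e) ->
     exists l, forall e : R, 0 < e -> exists N, forall n, (N <= n)%N ->
         abs (u n - l) < e) /\
  (forall x (e : R), 0 < e -> exists y, algebraic_over kinf y /\ abs (x - y) < e).

Definition Omega (z : K) : Prop := ~ kinf z.

Definition imag_abs (z : K) : R := inf [set abs (z - w) | w in kinf].

(* Gamma = PGL_2(A) is handled via GL_2(A) = matrices with unit determinant; *)
(* scalars (F^* ) lie in the upper triangular group, so                      *)
(* Gamma_infty \ Gamma = { B(A) g : g in GL_2(A) },  B(A) upper triangular.  *)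
Definition GL2A : set 'M[{poly F}]_2 := [set g | \det g \is a GRing.unit].
Definition Binf : set 'M[{poly F}]_2 := [set u | GL2A u /\ u i1 i0 = 0].
Definition rcoset (g : 'M[{poly F}]_2) : set 'M[{poly F}]_2 :=
  [set u *m g | u in Binf].
Definition cosets : set (set 'M[{poly F}]_2) := [set rcoset g | g in GL2A].

Definition mob (g : 'M[{poly F}]_2) (z : K) : K :=
  (emb (g i0 i0) * z + emb (g i0 i1)) / (emb (g i1 i0) * z + emb (g i1 i1)).

Definition cpow (x : R) (s : R[i]) : R[i] :=
  let r : R := expR (complex.Re s * ln x) in
  let th : R := complex.Im s * ln x in
  (r%:C)%C * ((cos th) +i* (sin th))%C.

(* sum of an (absolutely summable) complex family over a set *)
Definition csum (T : choiceType) (S : set T) (f : T -> R[i]) : R[i] :=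
  let ps g := fine (esum S (fun t => (Num.max (g t) 0)%:E)) in
  ((ps (fun t => complex.Re (f t)) - ps (fun t => - complex.Re (f t))) +i*
   (ps (fun t => complex.Im (f t)) - ps (fun t => - complex.Im (f t))))%C.

(* E(z,s) = sum_{gamma in Gamma_infty \ Gamma} |gamma z|_i^s ; the summand   *)
(* is evaluated at a representative of the coset (it is independent of it). *)
Definition Eis (z : K) (s : R[i]) : R[i] :=
  csum cosets (fun C => cpow (imag_abs (mob (xget 0 C) z)) s).

Definition polyv (m : nat) (v : {ffun 'I_m -> F}) : {poly F} := Poly (codom v).

(* Hecke operator: T_n f(z) = sum_{a monic, ad = n, deg b < deg d} f((az+b)/d).*)
(* Monic divisors a of n have size <= size n, enumerated by coefficient      *)
(* vectors of length size n; the b with deg b < deg d = (size d).-1 are      *)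
(* enumerated by coefficient vectors of length (size d).-1.                  *)
Definition hecke (f : K -> R[i]) (n : {poly F}) (z : K) : R[i] :=
  \sum_(t : {ffun 'I_(size n) -> F} | (polyv t \is monic) && (polyv t %| n))
    \sum_(v : {ffun 'I_((size (n %/ polyv t)).-1) -> F})
       f ((emb (polyv t) * z + emb (polyv v)) / emb (n %/ polyv t)).

Definition sigmaA (s : R[i]) (n : {poly F}) : R[i] :=
  \sum_(t : {ffun 'I_(size n) -> F} | (polyv t \is monic) && (polyv t %| n))
    cpow (absA (polyv t)) s.

End Cinf.

(* Main.v *)
Require Import Defs.
From mathcomp Require Import all_boot all_order all_algebra.
From mathcomp Require Import all_classical all_reals all_analysis.
From mathcomp Require Import complex.
From mathcomp Require Import ring lra.
Set Implicit Arguments. Unset Strict Implicit. Unset Printing Implicit Defensive.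
Import Order.TTheory GRing.Theory Num.Theory.
Local Open Scope ring_scope.
Local Open Scope classical_set_scope.

(* Let D_n be the set of cosets B g, for the matrices g over A whose determinant
   is n up to a unit, B being the upper triangular subgroup of GL_2(A), and let M run
   over the Hermite forms (a b; 0 d) with a monic, ad = n and deg b < deg d.
   Both (M, B g) |-> B g M and (M, B g) |-> B M g, with g the chosen
   representative of its coset, are bijections onto D_n. Sum |gz|_i^s over D_n.
   Through the first bijection this is T_n E(z, s). Since
   |gz|_i = |det g| |z|_i / |cz + d|^2, through the second it is
   sum_d |d| (|n| / |d|^2)^s E(z, s), the factor |d| counting the residues b.
   The rearrangements are licit because |cz + d| is bounded below by a multiple of
   max(|c|, |d|), which makes the series converge absolutely for Re s > 1. *)

(** * Two-by-two matrices over a commutative ring *)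

Section TwoByTwo.
Variable A : comPzRingType.
Implicit Types (a b c d : A) (g h : 'M[A]_2).

Definition mx2 a b c d : 'M[A]_2 :=
  \matrix_(i < 2, j < 2)
    (if i == i0 then if j == i0 then a else b else if j == i0 then c else d).

Lemma mx2_00 a b c d : mx2 a b c d i0 i0 = a. Proof. by rewrite mxE. Qed.
Lemma mx2_01 a b c d : mx2 a b c d i0 i1 = b. Proof. by rewrite mxE. Qed.
Lemma mx2_10 a b c d : mx2 a b c d i1 i0 = c. Proof. by rewrite mxE. Qed.
Lemma mx2_11 a b c d : mx2 a b c d i1 i1 = d. Proof. by rewrite mxE. Qed.
Definition mx2E := (mx2_00, mx2_01, mx2_10, mx2_11).

Lemma ord2P (i : 'I_2) : i = i0 \/ i = i1.
Proof. by case: i => [[|[|//]] p]; [left|right]; apply/val_inj. Qed.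

Lemma mx2_eta g : g = mx2 (g i0 i0) (g i0 i1) (g i1 i0) (g i1 i1).
Proof.
by apply/matrixP=> i j; case: (ord2P i) => ->; case: (ord2P j) => ->; rewrite mx2E.
Qed.

Lemma mx2_inj a b c d a' b' c' d' : mx2 a b c d = mx2 a' b' c' d' ->
  [/\ a = a', b = b', c = c' & d = d'].
Proof.
move=> e; split; first by rewrite -(mx2_00 a b c d) e mx2E.
- by rewrite -(mx2_01 a b c d) e mx2E.
- by rewrite -(mx2_10 a b c d) e mx2E.
- by rewrite -(mx2_11 a b c d) e mx2E.
Qed.

Lemma mulmx2E g h i j : (g *m h) i j = g i i0 * h i0 j + g i i1 * h i1 j.
Proof.
rewrite mxE big_ord_recl big_ord1.
by congr (g i _ * h _ j + g i _ * h _ j); apply/val_inj.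
Qed.

Lemma mul_mx2 a b c d a' b' c' d' :
  mx2 a b c d *m mx2 a' b' c' d' =
  mx2 (a * a' + b * c') (a * b' + b * d') (c * a' + d * c') (c * b' + d * d').
Proof. by rewrite [LHS]mx2_eta !mulmx2E !mx2E. Qed.

Lemma mx2_1 : 1%:M = mx2 1 0 0 1.
Proof. by rewrite [LHS]mx2_eta !mxE. Qed.

Lemma det_mx2E g : \det g = g i0 i0 * g i1 i1 - g i0 i1 * g i1 i0.
Proof.
rewrite (expand_det_row _ i0) big_ord_recl big_ord1 /cofactor !det_mx11 !mxE /=.
rewrite expr0 mul1r expr1 mulN1r mulrN.
by congr (g _ _ * g _ _ - g _ _ * g _ _); apply/val_inj.
Qed.

Lemma det_mx2 a b c d : \det (mx2 a b c d) = a * d - b * c.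
Proof. by rewrite det_mx2E !mx2E. Qed.

End TwoByTwo.

(** * Cosets of the upper triangular subgroup of GL_2(A) *)

Section Cosets.
Variable F : finFieldType.
Implicit Types (g h u : 'M[{poly F}]_2) (p q : {poly F}).

Lemma GL2A_unitmx g : GL2A g <-> g \in unitmx.
Proof. by rewrite unitmxE. Qed.

Lemma GL2A_mul g h : GL2A g -> GL2A h -> GL2A (g *m h).
Proof. by move=> /GL2A_unitmx ug /GL2A_unitmx uh; apply/GL2A_unitmx; rewrite unitmx_mul ug. Qed.

Lemma GL2A_inv g : GL2A g -> GL2A (invmx g).
Proof. by move=> /GL2A_unitmx ug; apply/GL2A_unitmx; rewrite unitmx_inv. Qed.

Lemma GL2A_det_neq0 g : GL2A g -> \det g != 0.
Proof. by move=> ug; apply: contraTneq ug => ->; rewrite unitr0. Qed.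

Lemma Binf1 : Binf (1%:M : 'M[{poly F}]_2).
Proof. by split; [apply/GL2A_unitmx/unitmx1|rewrite mx2_1 mx2E]. Qed.

Lemma Binf_mul g h : Binf g -> Binf h -> Binf (g *m h).
Proof.
move=> [ug g0] [uh h0]; split; first exact: GL2A_mul.
by rewrite mulmx2E g0 h0 mul0r mulr0 addr0.
Qed.

Lemma Binf_inv g : Binf g -> Binf (invmx g).
Proof.
move=> [ug g0]; split; first exact: GL2A_inv.
have := mulmxV ((GL2A_unitmx g).1 ug).
(* The lower left entry of [g *m invmx g] is [g i1 i1] times the wanted entry, and [g i1 i1] divides
   the nonzero determinant. *)
move=> /matrixP /(_ i1 i0); rewrite mulmx2E g0 mul0r add0r mxE /= => /eqP.
rewrite mulf_eq0 => /orP[/eqP g1|/eqP//].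
by have := GL2A_det_neq0 ug; rewrite det_mx2E g0 g1 !mulr0 subr0 eqxx.
Qed.

Lemma rcosetP g h : rcoset g = rcoset h <-> exists2 u, Binf u & g = u *m h.
Proof.
split=> [e|[u Bu ->]].
  have : rcoset g g by exists 1%:M; [exact: Binf1|rewrite mul1mx].
  by rewrite e => -[u Bu <-]; exists u.
apply/seteqP; split=> _ [v Bv <-].
  by exists (v *m u); [exact: Binf_mul|rewrite mulmxA].
exists (v *m invmx u); first by apply: Binf_mul => //; apply: Binf_inv.
have [/GL2A_unitmx uu _] := Bu.
by rewrite mulmxA mulmxKV.
Qed.

(** A coset contains each matrix that defines it, so the choice never falls back on the default
    0. *)
Lemma xget_coset (C : set 'M[{poly F}]_2) : cosets C -> GL2A (xget 0 C) /\ rcoset (xget 0 C) = C.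
Proof.
move=> [g Gg <-]; have : rcoset g (xget 0 (rcoset g)).
  by apply: xgetPex; exists g; exists 1%:M; [exact: Binf1|rewrite mul1mx].
move=> [u Bu <-]; split; first by apply: GL2A_mul => //; case: Bu.
by apply/rcosetP; exists u.
Qed.

(** The bottom row of [g *m invmx h] equals that of [h *m invmx h], namely (0 1). Cosets thus embed
    into pairs of polynomials, which is how the Eisenstein series gets bounded. *)
Lemma rcoset_bottom g h : GL2A g -> GL2A h ->
  g i1 i0 = h i1 i0 -> g i1 i1 = h i1 i1 -> rcoset g = rcoset h.
Proof.
move=> Gg Gh e0 e1; apply/rcosetP; exists (g *m invmx h); last first.
  by rewrite mulmxKV//; apply/GL2A_unitmx.
split; first by apply: GL2A_mul => //; apply: GL2A_inv.
rewrite mulmx2E e0 e1 -mulmx2E mulmxV; last exact/GL2A_unitmx.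
by rewrite mx2_1 mx2E.
Qed.

(** Divide [p] and [q] by their gcd and cancel it in the Bezout relation. The case p = 0 is apart,
    since the gcd may then vanish. The four polynomials are the entries of a matrix of GL_2(A) that
    clears an entry of a given matrix. *)
Lemma unimodular_annihilator p q : exists u v p' q' : {poly F},
  q' * p = p' * q /\ u * p' + v * q' \is a GRing.unit.
Proof.
have [->|p0] := eqVneq p 0.
  by exists 0, 1, 0, 1; rewrite mul0r mulr0 mul0r add0r mulr1 unitr1.
have [[u v] /= uv] := Bezoutp p q.
have [/dvdpP[p' ep] /dvdpP[q' eq]] := (dvdp_gcdl p q, dvdp_gcdr p q).
exists u, v, p', q'; split; first by rewrite {1}ep {2}eq; ring.
have h0 : gcdp p q != 0 by rewrite gcdp_eq0 negb_and p0.
move: uv; rewrite {1}ep {2}eq.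
have -> : u * (p' * gcdp p q) + v * (q' * gcdp p q) =
  (u * p' + v * q') * gcdp p q by ring.
move=> uv; have : (u * p' + v * q') * gcdp p q %= 1 * gcdp p q by rewrite mul1r.
rewrite eqp_mul2r// -size_poly_eq1 => s1.
case/size_poly1P: s1 => c c0 ->; by rewrite rmorph_unit ?unitfE.
Qed.

End Cosets.

(** * Hermite normal form and the two bijections onto the cosets of determinant n *)

Section HermiteForm.
Variable F : finFieldType.
Implicit Types (g h u : 'M[{poly F}]_2) (n p q : {poly F}).

Lemma coef_polyv m (v : {ffun 'I_m -> F}) (i : 'I_m) : (polyv v)`_i = v i.
Proof. by rewrite coef_Poly codom_ffun nth_fgraph_ord. Qed.

Lemma size_polyv m (v : {ffun 'I_m -> F}) : (size (polyv v) <= m)%N.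
Proof. by rewrite (leq_trans (size_Poly _))// size_codom card_ord. Qed.

Lemma polyv_inj m : injective (@polyv F m).
Proof. by move=> v w e; apply/ffunP => i; rewrite -!coef_polyv e. Qed.

Definition coefv m p : {ffun 'I_m -> F} := [ffun i : 'I_m => p`_i].

Lemma coefvK m p : (size p <= m)%N -> polyv (coefv m p) = p.
Proof.
move=> sp; apply/polyP => i; case: (ltnP i m) => im.
  by rewrite (coef_polyv _ (Ordinal im)) ffunE.
by rewrite !nth_default// ?(leq_trans sp)// (leq_trans (size_polyv _)).
Qed.

Lemma unit_polyP p : p \is a GRing.unit -> exists2 c : F, c != 0 & p = c%:P.
Proof. by rewrite poly_unitE => /andP[/size_poly1P]. Qed.

Lemma polyC_unit (c : F) : c != 0 -> c%:P \is a GRing.unit.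
Proof. by move=> c0; rewrite rmorph_unit ?unitfE. Qed.

(** The dependent pair (a, b) follows the nested sums of [hecke]. That a is a monic divisor is left
    to [hermite_valid], so that the index set stays a finite type. *)
Definition hermite_index n :=
  {t : {ffun 'I_(size n) -> F} & {ffun 'I_(size (n %/ polyv t)).-1 -> F}}.

Definition hermite_valid n (j : hermite_index n) :=
  (polyv (tag j) \is monic) && (polyv (tag j) %| n).

Definition hermite_mx n (j : hermite_index n) : 'M[{poly F}]_2 :=
  mx2 (polyv (tag j)) (polyv (tagged j)) 0 (n %/ polyv (tag j)).

Lemma det_hermite_mx n (j : hermite_index n) :
  hermite_valid j -> \det (hermite_mx j) = n.
Proof. by move=> /andP[_ dv]; rewrite det_mx2 mulr0 subr0 mulrC divpK. Qed.

(** The unit factors of the diagonal entries go into [u], which makes a monic and d = n / a; the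
    upper right entry is then reduced modulo d, its quotient also going into [u]. *)
Lemma hermite_exists n g : n != 0 -> g i1 i0 = 0 -> \det g %= n ->
  exists u (j : hermite_index n), [/\ Binf u, hermite_valid j & g = u *m hermite_mx j].
Proof.
move=> n0; rewrite (mx2_eta g) mx2E => ->.
move: (g i0 i0) (g i0 i1) (g i1 i1) => p q r; rewrite det_mx2 mulr0 subr0 => prn.
have pr0 : p * r != 0 by rewrite -eqp0 (eqp_ltrans prn) eqp0.
have /andP[p0 r0] : (p != 0) && (r != 0) by rewrite -negb_or -mulf_eq0.
set c := lead_coef p; have c0 : c != 0 by rewrite lead_coef_eq0.
set a := c^-1 *: p.
have am : a \is monic by rewrite monicE lead_coefZ mulVf.
have pa : p = c *: a by rewrite scalerA mulfV// scale1r.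
have ap : p %= a by apply/eqpf_eq; exists c.
have an : a %| n by rewrite -(eqp_dvdl _ ap) -(eqp_dvdr _ prn) dvdp_mulr.
set d := n %/ a.
have nE : n = d * a by rewrite divpK.
have a0 : a != 0 by rewrite monic_neq0.
have d0 : d != 0 by apply: contraNneq n0 => d0; rewrite nE d0 mul0r.
have /eqpf_eq[e e0 re] : r %= d.
  rewrite -(eqp_mul2r _ _ a0) -nE (eqp_trans _ prn)// mulrC eqp_mul2r//.
  by rewrite eqp_sym.
have [t et] : exists t : {ffun 'I_(size n) -> F}, polyv t = a.
  by exists (coefv _ a); rewrite coefvK// dvdp_leq.
have [v ev] : exists v : {ffun 'I_(size (n %/ polyv t)).-1 -> F},
    polyv v = (c^-1 *: q) %% d.
  exists (coefv _ ((c^-1 *: q) %% d)); rewrite coefvK//.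
  (* A remainder modulo d has size below [size d], hence at most [(size d).-1], the length of the
     vectors that encode b. *)
  rewrite et -/d -ltnS prednK ?ltn_modp//.
  by rewrite lt0n size_poly_eq0.
exists (mx2 c%:P (c *: ((c^-1 *: q) %/ d)) 0 e%:P).
exists (Tagged (fun t => {ffun 'I_(size (n %/ polyv t)).-1 -> F}) v).
split.
- split; last by rewrite mx2E.
  by rewrite /GL2A /= det_mx2 mulr0 subr0 unitrM !polyC_unit.
- by rewrite /hermite_valid /= et am.
- rewrite /hermite_mx /= ev et -/d mul_mx2 !mulr0 !mul0r !addr0 !add0r !mul_polyC.
  congr mx2 => //; rewrite -scalerAl -scalerDr addrC -divp_eq.
  by rewrite scalerA mulfV// scale1r.
Qed.

Lemma hermite_unique n (j j' : hermite_index n) g : n != 0 ->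
  hermite_valid j -> hermite_valid j' -> GL2A g ->
  g *m hermite_mx j = hermite_mx j' -> g = 1%:M /\ j = j'.
Proof.
move=> n0; case: j j' => [t v] [t' v'] /andP[/= m dv] /andP[/= m' dv'].
rewrite /hermite_mx /= (mx2_eta g).
move: (g i0 i0) (g i0 i1) (g i1 i0) (g i1 i1) => p q r s.
rewrite /GL2A /= det_mx2 mul_mx2 => + /mx2_inj[].
have t0 : polyv t != 0 by rewrite monic_neq0.
rewrite !mulr0 !addr0 => + ea eb /eqP; rewrite mulf_eq0 (negPf t0) orbF => + /eqP r0.
rewrite r0 mulr0 subr0 mul0r add0r unitrM => /andP[/unit_polyP[c c0 ep] _] ed.
have c1 : c = 1.
  move: ea => /(congr1 lead_coef); rewrite ep mul_polyC lead_coefZ.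
  by rewrite (monicP m) (monicP m') mulr1.
move: ea; rewrite ep c1 mul1r => /polyv_inj ett; subst t'.
have d0 : n %/ polyv t != 0 by rewrite divp_eq0 !negb_or n0 t0 -leqNgt dvdp_leq.
have s1 : s = 1 by apply: (mulIf d0); rewrite mul1r.
(* The product q d is the difference of two residues b' and b, so its size is below that of d. *)
have q0 : q = 0.
  apply/eqP; apply: contraT => q0.
  have : (size (q * (n %/ polyv t))%R < size (n %/ polyv t)%R)%N.
    have -> : q * (n %/ polyv t) = polyv v' - polyv v.
      by rewrite -eb ep c1 mul1r addrAC subrr add0r.
    have h (w : {ffun 'I_(size (n %/ polyv t)).-1 -> F}) :
        (size (polyv w) < size (n %/ polyv t)%R)%N.
      by rewrite (leq_ltn_trans (size_polyv _))// prednK// lt0n size_poly_eq0.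
    by rewrite (leq_ltn_trans (size_polyD _ _))// size_polyN gtn_max !h.
  by rewrite ltnNge size_mul// (polySpred q0) addSn /= leq_addl.
rewrite s1 q0 -mx2_1; split => //.
by move: eb; rewrite ep c1 q0 mul0r addr0 mul1r => /polyv_inj ->.
Qed.

(** Determinants are taken up to associates, so the underlying set of matrices is stable under
    GL_2(A) on both sides. *)
Definition det_cosets n : set (set 'M[{poly F}]_2) :=
  [set rcoset g | g in [set g | \det g %= n]].

Lemma eqp_mull_unit p q : p \is a GRing.unit -> p * q %= q.
Proof. by move=> /unit_polyP[c c0 ->]; apply/eqpf_eq; exists c; rewrite ?mul_polyC. Qed.

(** The second row of [h] annihilates the first column of [g]; the Bezout coefficients form the
    first row. *)
Lemma triangular_left g : exists2 h, GL2A h & (h *m g) i1 i0 = 0.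
Proof.
have [u [v [p [q [e un]]]]] := unimodular_annihilator (g i0 i0) (g i1 i0).
exists (mx2 u v (- q) p); first by rewrite /GL2A /= det_mx2 mulrN opprK.
by rewrite mulmx2E !mx2E mulNr e addrC subrr.
Qed.

(** The first column of [h] is annihilated by the second row of [g]; the Bezout coefficients form
    the second column. *)
Lemma triangular_right g : exists2 h, GL2A h & (g *m h) i1 i0 = 0.
Proof.
have [u [v [p [q [e un]]]]] := unimodular_annihilator (g i1 i0) (g i1 i1).
exists (mx2 q u (- p) v).
  rewrite /GL2A /= det_mx2.
  by have -> : q * v - u * - p = u * p + v * q by ring.
by rewrite mulmx2E !mx2E mulrN mulrC e (mulrC p) subrr.
Qed.

(** If g M = u g' M', then uniqueness applied to (u g')^-1 g gives M = M' and g = u g'. For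
    surjectivity, h g = u M gives g = (h^-1 u) M; passing to the chosen representative of the coset
    of h^-1 u only adds a left factor in B. *)
Lemma det_cosets_bijl n : n != 0 ->
  set_bij ([set j : hermite_index n | hermite_valid j] `*` @cosets F) (det_cosets n)
    (fun k => rcoset (xget 0 k.2 *m hermite_mx k.1)).
Proof.
move=> n0; split.
- move=> [j C] [/= vj cC]; have [GC _] := xget_coset cC.
  by exists (xget 0 C *m hermite_mx j) => //=; rewrite det_mulmx det_hermite_mx// eqp_mull_unit.
- move=> [j C] [j' C'] /set_mem[/= vj cC] /set_mem[/= vj' cC'].
  have [[GC rC] [GC' rC']] := (xget_coset cC, xget_coset cC').
  move=> /rcosetP[u Bu]; rewrite mulmxA => e.
  have Gu : GL2A (u *m xget 0 C') by apply: GL2A_mul => //; case: Bu.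
  have uu : u *m xget 0 C' \in unitmx by apply/GL2A_unitmx.
  have := congr1 (mulmx (invmx (u *m xget 0 C'))) e.
  rewrite (mulKmx uu) mulmxA => /(hermite_unique n0 vj vj')[].
    by apply: GL2A_mul => //; apply: GL2A_inv.
  move=> e1 ->; congr pair; rewrite -rC -rC'; apply/rcosetP; exists u => //.
  by rewrite -[LHS](mulKVmx uu) e1 mulmx1.
- move=> _ [g /= dg <-]; have [h Gh hg] := triangular_left g.
  have [|u [j [Bu vj e]]] := hermite_exists n0 hg.
    by rewrite det_mulmx (eqp_trans _ dg)// eqp_mull_unit.
  have uh : h \in unitmx by apply/GL2A_unitmx.
  have G : GL2A (invmx h *m u) by apply: GL2A_mul; [apply: GL2A_inv|case: Bu].
  have cC : cosets (rcoset (invmx h *m u)) by exists (invmx h *m u).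
  exists (j, rcoset (invmx h *m u)) => //=.
  have [_ /rcosetP[w Bw ->]] := xget_coset cC.
  apply/rcosetP; exists w => //.
  by rewrite -[in RHS](mulKmx uh g) e !mulmxA.
Qed.

(** Here M stands between B and the representative, so changing the representative changes the image
    coset. The map is still bijective for the choice made by [xget]. *)
Lemma det_cosets_bijr n : n != 0 ->
  set_bij ([set j : hermite_index n | hermite_valid j] `*` @cosets F) (det_cosets n)
    (fun k => rcoset (hermite_mx k.1 *m xget 0 k.2)).
Proof.
move=> n0; split.
- move=> [j C] [/= vj cC]; have [GC _] := xget_coset cC.
  exists (hermite_mx j *m xget 0 C) => //=.
  by rewrite det_mulmx det_hermite_mx// mulrC eqp_mull_unit.
- move=> [j C] [j' C'] /set_mem[/= vj cC] /set_mem[/= vj' cC'].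
  have [[GC rC] [GC' rC']] := (xget_coset cC, xget_coset cC').
  move=> /rcosetP[u Bu]; rewrite mulmxA => e.
  have [uC uC'] : xget 0 C \in unitmx /\ xget 0 C' \in unitmx.
    by split; apply/GL2A_unitmx.
  have eC : C = C'.
    rewrite -rC -rC'; apply/rcosetP; exists (xget 0 C *m invmx (xget 0 C')); last first.
      by rewrite mulmxKV.
    split; first by apply: GL2A_mul => //; apply: GL2A_inv.
    (* From M g = u M' g' one gets M (g g'^-1) = u M', which is upper triangular; as d is nonzero, g
       g'^-1 lies in B. *)
    have := congr1 (mulmx^~ (invmx (xget 0 C'))) e.
    rewrite /= (mulmxK uC') -mulmxA => /matrixP /(_ i1 i0).
    rewrite !mulmx2E !mx2E Bu.2 !mulr0 !mul0r !addr0 !add0r => /eqP.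
    rewrite mulf_eq0 => /orP[|/eqP//].
    have /andP[_ dv] := vj => /eqP dv0.
    by move: n0; rewrite -(divpK dv) dv0 mul0r eqxx.
  subst C'; congr pair.
  have := congr1 (mulmx^~ (invmx (xget 0 C))) e; rewrite /= !(mulmxK uC) => /esym.
  by move=> /(hermite_unique n0 vj' vj)[]//; case: Bu.
- move=> _ [g /= dg <-]; have [h Gh hg] := triangular_right g.
  have uh : h \in unitmx by apply/GL2A_unitmx.
  have cC : cosets (rcoset (invmx h)) by exists (invmx h) => //; apply: GL2A_inv.
  have [_ /rcosetP[w Bw ew]] := xget_coset cC.
  have uw : w \in unitmx by case: Bw => /GL2A_unitmx.
  (* The chosen representative of the coset of h^-1 is w h^-1. Reducing g h w^-1 to u M compensates
     for w, as g = u M (w h^-1). *)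
  have [| |u [j [Bu vj e]]] := @hermite_exists n (g *m h *m invmx w) n0.
  + by rewrite mulmx2E hg (Binf_inv Bw).2 mul0r mulr0 addr0.
  + rewrite !det_mulmx -mulrA mulrC (eqp_trans _ dg)// eqp_mull_unit//.
    by rewrite -det_mulmx; apply: GL2A_mul => //; apply: GL2A_inv; case: Bw.
  exists (j, rcoset (invmx h)) => //=; apply/esym/rcosetP; exists u => //.
  by rewrite mulmxA -e ew mulmxA mulmxKV// mulmxK.
Qed.

End HermiteForm.

(** * Linearity of absolutely convergent real and complex sums *)

Section ComplexSums.
Variables (R : realType) (T : choiceType).
Implicit Types (S : set T) (f g : T -> R).

Definition rsum S f : R :=
  fine (\esum_(t in S) (Num.max (f t) 0)%:E) - fine (\esum_(t in S) (Num.max (- f t) 0)%:E).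

Lemma csumE S (f : T -> R[i]) :
  csum S f = (rsum S (fun t => complex.Re (f t)) +i* rsum S (fun t => complex.Im (f t)))%C.
Proof. by []. Qed.

Lemma rsumE S f : rsum S f =
  fine (\esum_(t in S) (EFin \o f)^\+%E t) - fine (\esum_(t in S) (EFin \o f)^\-%E t).
Proof.
by congr (fine _ - fine _); apply: eq_esum => t _; rewrite ?funeposE ?funenegE/= EFin_max.
Qed.

Definition rsummable S f := summable S (EFin \o f).

Lemma rsummable_le S f g : rsummable S g -> (forall t, S t -> `|f t| <= g t) -> rsummable S f.
Proof.
move=> sg fg; apply: le_lt_trans sg; apply: le_esum => t St /=.
by rewrite lee_fin (le_trans (fg _ St))// ler_norm.
Qed.

Lemma rsummable_eq S f g : rsummable S f -> (forall t, S t -> g t = f t) -> rsummable S g.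
Proof. by move=> sf gf; apply: le_lt_trans sf; apply: le_esum => t St /=; rewrite gf. Qed.

Lemma rsummableD S f g : rsummable S f -> rsummable S g -> rsummable S (fun t => f t + g t).
Proof. by move=> sf sg; apply: le_lt_trans (summableD sf sg). Qed.

Lemma summable_esum_fin S (f : T -> \bar R) : (forall t, S t -> 0 <= f t)%E ->
  summable S f -> \esum_(t in S) f t \is a fin_num.
Proof.
move=> f0 sf; rewrite ge0_fin_numE; last exact: esum_ge0.
by apply: le_lt_trans sf; apply: le_esum => t St; rewrite gee0_abs ?f0.
Qed.

(** Any splitting into nonnegative summable functions gives the same value as the positive and
    negative parts. This is what additivity needs, as the positive part of a sum is not the sum of
    the positive parts. *)
Lemma rsum_sub S f (p q : T -> R) : rsummable S p -> rsummable S q ->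
  (forall t, S t -> 0 <= p t) -> (forall t, S t -> 0 <= q t) ->
  (forall t, S t -> f t = p t - q t) ->
  rsum S f = fine (\esum_(t in S) (p t)%:E) - fine (\esum_(t in S) (q t)%:E).
Proof.
move=> sp sq p0 q0 fE.
have sd := summableB sp sq.
have e := esumB sp sq p0 q0.
have fp : \esum_(t in S) (EFin \o p) t \is a fin_num by apply: summable_esum_fin.
have fq : \esum_(t in S) (EFin \o q) t \is a fin_num by apply: summable_esum_fin.
have hp : \esum_(t in S) ((EFin \o p) \- (EFin \o q))^\+%E t \is a fin_num.
  by apply: summable_esum_fin => //; apply: summable_funepos.
have hq : \esum_(t in S) ((EFin \o p) \- (EFin \o q))^\-%E t \is a fin_num.
  by apply: summable_esum_fin => //; apply: summable_funeneg.
rewrite rsumE -!fineB//.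
- rewrite -e; congr (fine (_ - _)); apply: eq_esum => t St.
    by rewrite !funeposE /= fE.
  by rewrite !funenegE /= fE.
- by rewrite (eq_esum (b := ((EFin \o p) \- (EFin \o q))^\+%E))// => t St; rewrite !funeposE/= fE.
- by rewrite (eq_esum (b := ((EFin \o p) \- (EFin \o q))^\-%E))// => t St; rewrite !funenegE/= fE.
Qed.

Lemma rsummable_pos S f : rsummable S f -> rsummable S (fun t => Num.max (f t) 0).
Proof.
move=> sf; apply: (@rsummable_le _ _ (fun t => `|f t|)).
  by apply: le_lt_trans sf; apply: le_esum => t _; rewrite /= normr_id.
by move=> t _; case: (leP (f t) 0); rewrite ?normr0.
Qed.

Lemma rsum_eq S f g : (forall t, S t -> f t = g t) -> rsum S f = rsum S g.
Proof. by move=> fg; congr (fine _ - fine _); apply: eq_esum => t St; rewrite fg. Qed.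

Lemma esum_scale_le S (a : T -> \bar R) (c : R) : 0 <= c -> (forall t, 0 <= a t)%E ->
  (\esum_(t in S) (c%:E * a t) <= c%:E * \esum_(t in S) a t)%E.
Proof.
move=> c0 a0; apply: ge_ereal_sup => _ [X [finX XS] <-].
rewrite -ge0_mule_fsumr//.
by apply: lee_wpmul2l; rewrite ?lee_fin//; apply: ereal_sup_ubound; exists X.
Qed.

Lemma esum_scale S (a : T -> \bar R) (c : R) : 0 <= c -> (forall t, 0 <= a t)%E ->
  (\esum_(t in S) (c%:E * a t) = c%:E * \esum_(t in S) a t)%E.
Proof.
move=> c0 a0; apply/eqP; rewrite eq_le esum_scale_le//=.
have [->|cn0] := eqVneq c 0; first by rewrite mul0e esum_ge0// => t St; rewrite mul0e.
have {cn0} c0 : 0 < c by rewrite lt_def cn0.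
have e : \esum_(t in S) a t = \esum_(t in S) (c^-1%:E * (c%:E * a t))%E.
  by apply: eq_esum => t St; rewrite muleA -EFinM mulVf ?gt_eqF// mul1e.
rewrite [in leLHS]e (le_trans (lee_wpmul2l _ (esum_scale_le _ _ _)))//.
- by rewrite lee_fin ltW.
- by rewrite invr_ge0 ltW.
- by move=> t; rewrite mule_ge0 ?a0// lee_fin ltW.
by rewrite muleA -EFinM mulfV ?gt_eqF// mul1e.
Qed.

Lemma rsummableZ S f (c : R) : rsummable S f -> rsummable S (fun t => c * f t).
Proof.
move=> sf; rewrite /rsummable /summable.
rewrite (eq_esum (b := fun t => `|c|%:E * `|(EFin \o f) t|)%E); last first.
  by move=> t _ /=; rewrite normrM.
by rewrite esum_scale// lte_mul_pinfty// lee_fin.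
Qed.

Lemma maxr0_sub (x : R) : x = Num.max x 0 - Num.max (- x) 0.
Proof. by case: (leP x 0); case: (leP (- x) 0); lra. Qed.

Lemma maxr0_ge0 (x : R) : 0 <= Num.max x 0.
Proof. by rewrite le_max lexx orbT. Qed.

Lemma rsummable_neg S f : rsummable S f -> rsummable S (fun t => Num.max (- f t) 0).
Proof.
move=> sf; apply: (@rsummable_pos _ (fun t => - f t)).
by apply: le_lt_trans sf; apply: le_esum => t _; rewrite /= normrN.
Qed.

Lemma rsumD S f g : rsummable S f -> rsummable S g ->
  rsum S (fun t => f t + g t) = rsum S f + rsum S g.
Proof.
move=> sf sg.
rewrite (@rsum_sub _ _ (fun t => Num.max (f t) 0 + Num.max (g t) 0)
                      (fun t => Num.max (- f t) 0 + Num.max (- g t) 0)).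
- have fin h : rsummable S h -> (forall t, 0 <= h t) -> \esum_(t in S) (h t)%:E \is a fin_num.
    by move=> sh h0; apply: summable_esum_fin sh => t _; rewrite lee_fin.
  have sp := rsummable_pos; have sn := rsummable_neg.
  have ge0 := maxr0_ge0.
  rewrite (eq_esum (b := fun t => (Num.max (f t) 0)%:E + (Num.max (g t) 0)%:E)%E)//.
  rewrite [X in _ - fine X](eq_esum
    (b := fun t => (Num.max (- f t) 0)%:E + (Num.max (- g t) 0)%:E)%E)//.
  rewrite !esumD//; try by move=> *; rewrite lee_fin.
  rewrite !fineD ?fin//; first by rewrite /rsum; ring.
  + exact: sn.
  + exact: sn.
  + exact: sp.
  + exact: sp.
- by apply: rsummableD; apply: rsummable_pos.
- by apply: rsummableD; apply: rsummable_neg.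
- by move=> *; rewrite addr_ge0 ?maxr0_ge0.
- by move=> *; rewrite addr_ge0 ?maxr0_ge0.
- by move=> t _; rewrite {1}(maxr0_sub (f t)) {1}(maxr0_sub (g t)); ring.
Qed.

Lemma rsumN S f : rsum S (fun t => - f t) = - rsum S f.
Proof.
rewrite /rsum opprB; congr (_ - fine _).
by apply: eq_esum => t _; rewrite opprK.
Qed.

Lemma rsumZ S f (c : R) : rsummable S f -> rsum S (fun t => c * f t) = c * rsum S f.
Proof.
move=> sf.
(* A negative factor exchanges positive and negative parts, which [rsumN] accounts for; a
   nonnegative one commutes with both. *)
wlog c0 : c / 0 <= c => [H|].
  case: (leP 0 c) => c0; first exact: H.
  have := H (- c); rewrite oppr_ge0 (ltW c0) => /(_ isT).
  rewrite (@rsum_eq _ _ (fun t => - (c * f t))); last by move=> *; rewrite mulNr.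
  by rewrite rsumN mulNr => /oppr_inj.
have h (x : R) : Num.max (c * x) 0 = c * Num.max x 0 by rewrite maxr_pMr ?mulr0.
rewrite /rsum mulrBr.
rewrite (eq_esum (b := fun t => c%:E * (Num.max (f t) 0)%:E)%E); last first.
  by move=> t _; rewrite h EFinM.
rewrite [X in _ - fine X](eq_esum (b := fun t => c%:E * (Num.max (- f t) 0)%:E)%E); last first.
  by move=> t _; rewrite -mulrN h EFinM.
rewrite !esum_scale//; try by move=> *; rewrite lee_fin maxr0_ge0.
rewrite !fineM//; apply: summable_esum_fin => *; rewrite ?lee_fin ?maxr0_ge0//.
  exact: rsummable_neg.
exact: rsummable_pos.
Qed.

Definition csummable S (f : T -> R[i]) :=
  rsummable S (fun t => complex.Re (f t)) /\ rsummable S (fun t => complex.Im (f t)).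

Lemma csumZ S (f : T -> R[i]) (c : R[i]) : csummable S f ->
  csum S (fun t => c * f t) = c * csum S f.
Proof.
move=> [sr si]; rewrite !csumE; case: c => x y.
have er t : complex.Re ((x +i* y)%C * f t) =
    x * complex.Re (f t) + - y * complex.Im (f t).
  by case: (f t) => u v /=; rewrite mulNr.
have ei t : complex.Im ((x +i* y)%C * f t) =
    x * complex.Im (f t) + y * complex.Re (f t).
  by case: (f t) => u v /=.
rewrite (rsum_eq (fun t _ => er t)) (rsum_eq (fun t _ => ei t)).
by rewrite !rsumD ?rsumZ//; try exact: rsummableZ; rewrite mulNr.
Qed.

Lemma csummableZ S (f : T -> R[i]) (c : R[i]) : csummable S f ->
  csummable S (fun t => c * f t).
Proof.
move=> [sr si]; case: c => x y; split.
  apply: (rsummable_eq (rsummableD (rsummableZ x sr) (rsummableZ (- y) si))) => t _.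
  by case: (f t) => u v /=; rewrite mulNr.
apply: (rsummable_eq (rsummableD (rsummableZ x si) (rsummableZ y sr))) => t _.
by case: (f t) => u v /=.
Qed.

Lemma csummable_eq S (f g : T -> R[i]) : csummable S f ->
  (forall t, S t -> g t = f t) -> csummable S g.
Proof.
move=> [sr si] gf.
by split; [apply: (rsummable_eq sr)|apply: (rsummable_eq si)] => t St; rewrite gf.
Qed.

Lemma csum_eq S (f g : T -> R[i]) : (forall t, S t -> f t = g t) -> csum S f = csum S g.
Proof. by move=> fg; rewrite !csumE; congr Complex; apply: rsum_eq => t St; rewrite fg. Qed.

End ComplexSums.

(** * Sums over a set split into finitely many copies of another *)

Lemma esum_pred (R : realType) (J : finType) (V : pred J) (a : J -> \bar R) :
  (forall j, 0 <= a j)%E -> (\esum_(j in [set j | V j]) a j = \sum_(j | V j) a j)%E.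
Proof.
move=> a0; rewrite esum_fset//; last exact: finite_finset.
by rewrite -(@bigfs _ _ _ _ (index_enum J) V)// ?index_enum_uniq// => j _; rewrite mem_index_enum.
Qed.

Section Partition.
Variables (R : realType) (T T' : choiceType) (J : finType) (V : pred J).
Variables (S : set T) (S' : set T') (e : J * T -> T').
Hypothesis be : set_bij ([set j | V j] `*` S) S' e.

Lemma esum_partition (a : T' -> \bar R) : (forall t, 0 <= a t)%E ->
  (\esum_(t in S') a t = \sum_(j | V j) \esum_(t in S) a (e (j, t)))%E.
Proof.
move=> a0; rewrite (reindex_esum _ _ _ _ be).
rewrite (_ : _ `*` _ = [set j | V j] `*`` (fun _ => S)); last first.
  by apply/seteqP; split => -[].
transitivity (\esum_(k in [set j | V j] `*`` (fun _ => S)) a (e (k.1, k.2))).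
  by apply: eq_esum => -[].
rewrite -(@esum_esum _ _ _ _ _ (fun j t => a (e (j, t))))//.
by rewrite esum_pred// => j; apply: esum_ge0.
Qed.

(** Since [fine] sends infinity to 0, it commutes with the finite sum only when each slice has a
    finite sum; hence the summability hypothesis. *)
Lemma rsum_partition (f : T' -> R) :
  (forall j, V j -> rsummable S (fun t => f (e (j, t)))) ->
  rsum S' f = \sum_(j | V j) rsum S (fun t => f (e (j, t))).
Proof.
move=> sf; rewrite /rsum !esum_partition//; try by move=> *; rewrite lee_fin maxr0_ge0.
rewrite -!sum_fine ?sumrB// => j Vj; apply: summable_esum_fin => *;
  rewrite ?lee_fin ?maxr0_ge0//.
  exact: rsummable_neg (sf _ Vj).
exact: rsummable_pos (sf _ Vj).
Qed.

Lemma csum_partition (f : T' -> R[i]) :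
  (forall j, V j -> csummable S (fun t => f (e (j, t)))) ->
  csum S' f = \sum_(j | V j) csum S (fun t => f (e (j, t))).
Proof.
move=> sf; rewrite csumE !rsum_partition//; try by move=> j /sf[].
by elim/big_rec3: _ => [//|j x y z Vj <-]; rewrite csumE.
Qed.

End Partition.

(** * The imaginary absolute value and its behaviour under Moebius maps *)

Section ImaginaryPart.
Variables (F : finFieldType) (R : realType) (K : closedFieldType).
Variables (abs : K -> R) (emb : {rmorphism {poly F} -> K}).
Hypothesis cinf : is_Cinf abs emb.
Implicit Types (x y z : K) (a b c d : {poly F}) (g h : 'M[{poly F}]_2).

Local Notation imag := (imag_abs abs emb).
Local Notation q := (qF F R).

Lemma qF_gt1 : 1 < q.
Proof. by rewrite /qF ltr1n card_finNzRing_gt1. Qed.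

Lemma absA_gt0 a : a != 0 -> 0 < absA R a.
Proof. by move=> a0; rewrite /absA (negPf a0) exprn_gt0// (lt_trans ltr01 qF_gt1). Qed.

Lemma abs_eq0 x : abs x = 0 <-> x = 0. Proof. by case: cinf. Qed.
Lemma abs_ge0 x : 0 <= abs x. Proof. by case: cinf => _ []. Qed.
Lemma absM x y : abs (x * y) = abs x * abs y. Proof. by case: cinf => _ [_ []]. Qed.
Lemma absD_le x y : abs (x + y) <= Num.max (abs x) (abs y).
Proof. by case: cinf => _ [_ [_ []]]. Qed.
Lemma abs_emb a : abs (emb a) = absA R a. Proof. by case: cinf => _ [_ [_ [_ []]]]. Qed.

Lemma abs0 : abs 0 = 0. Proof. exact/abs_eq0. Qed.

Lemma abs1 : abs 1 = 1.
Proof. by rewrite -(rmorph1 emb) abs_emb /absA oner_eq0 size_poly1 expr0. Qed.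

Lemma absN x : abs (- x) = abs x.
Proof.
rewrite -mulN1r absM -(rmorph1 emb) -rmorphN abs_emb /absA oppr_eq0 oner_eq0.
by rewrite size_polyN size_poly1 expr0 mul1r.
Qed.

Lemma absB_le x y : abs (x - y) <= Num.max (abs x) (abs y).
Proof. by rewrite -(absN y) absD_le. Qed.

Lemma abs_gt0 x : x != 0 -> 0 < abs x.
Proof. by move=> x0; rewrite lt_def abs_ge0 andbT; apply: contra_neq x0 => /abs_eq0. Qed.

Lemma absV x : abs x^-1 = (abs x)^-1.
Proof.
have [->|x0] := eqVneq x 0; first by rewrite invr0 abs0 invr0.
apply: (mulfI (lt0r_neq0 (abs_gt0 x0))).
by rewrite -absM !mulfV ?abs1// lt0r_neq0 ?abs_gt0.
Qed.

Lemma emb_eq0 a : (emb a == 0) = (a == 0).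
Proof.
apply/eqP/eqP => [|->]; last by rewrite rmorph0.
move=> /abs_eq0; rewrite abs_emb => e; apply/eqP; apply: contraT => /absA_gt0.
by rewrite e ltxx.
Qed.

Lemma kinf_frac a b : b != 0 -> kinf abs emb (emb a / emb b).
Proof. by move=> b0 e e0; exists a, b; rewrite subrr abs0. Qed.

Lemma imag_le z w : kinf abs emb w -> imag z <= abs (z - w).
Proof.
move=> kw; apply: ge_inf; last by exists w.
by exists 0 => _ [v _ <-]; exact: abs_ge0.
Qed.

(* F_q(T) is dense in k_infty, so it suffices to bound distances to fractions. *)
Lemma imag_ge z (t : R) : 0 < t ->
  (forall a b, b != 0 -> t <= abs (z - emb a / emb b)) -> t <= imag z.
Proof.
move=> t0 tz; apply: lb_le_inf.
  exists (abs (z - emb 0 / emb 1)); exists (emb 0 / emb 1) => //.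
  by apply: kinf_frac; rewrite oner_neq0.
move=> _ [w kw <-]; rewrite leNgt; apply/negP => zw.
have [a [b [b0 ab]]] := kw _ t0.
have := tz a b b0; rewrite leNgt => /negP; apply.
have -> : z - emb a / emb b = (z - w) + (w - emb a / emb b) by ring.
by rewrite (le_lt_trans (absD_le _ _))// gt_max zw.
Qed.

(** The set [kinf] is a closure by definition, so a point outside it stays at a positive distance
    from all fractions. *)
Lemma OmegaP z : Omega abs emb z <-> 0 < imag z.
Proof.
split=> [Oz|z0 kz]; last by have := imag_le z kz; rewrite subrr abs0 leNgt z0.
have [e /not_implyP[e0 ne]] := (existsNP _).2 Oz.
apply: (lt_le_trans e0); apply: imag_ge => // a b b0.
by rewrite leNgt; apply/negP => zab; apply: ne; exists a, b.
Qed.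

(** For c nonzero, cz + d = c (z - (-d/c)), and -d/c lies in k_infty. *)
Lemma imag_linear_le z c d : abs (emb c) * imag z <= abs (emb c * z + emb d).
Proof.
have [->|c0] := eqVneq c 0; first by rewrite rmorph0 abs0 mul0r abs_ge0.
have ec : emb c != 0 by rewrite emb_eq0.
have -> : emb c * z + emb d = emb c * (z - emb (- d) / emb c).
  by rewrite rmorphN; field.
by rewrite absM ler_wpM2l ?abs_ge0// imag_le//; apply: kinf_frac.
Qed.

Lemma linear_neq0 z c d : Omega abs emb z -> (c != 0) || (d != 0) ->
  emb c * z + emb d != 0.
Proof.
move=> /OmegaP z0; have [->|c0 _] := eqVneq c 0.
  by rewrite rmorph0 mul0r add0r /= emb_eq0.
apply: contraTneq (imag_linear_le z c d) => ->; rewrite abs0 -ltNge.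
by rewrite mulr_gt0// abs_gt0// emb_eq0.
Qed.

(* With X = az + b and Y = cz + d one has aY - cX = ad - bc, while
   |a| |z|_i <= |X| and |c| |z|_i <= |Y|; conclude by the ultrametric inequality. *)
Lemma imag_det_le z a b c d :
  abs (emb (a * d - b * c)) * imag z <=
  abs (emb a * z + emb b) * abs (emb c * z + emb d).
Proof.
set X := emb a * z + emb b; set Y := emb c * z + emb d.
have -> : emb (a * d - b * c) = emb a * Y - emb c * X.
  by rewrite /X /Y rmorphB !rmorphM; ring.
have [z0|z0] := leP (imag z) 0.
  by rewrite (le_trans (mulr_ge0_le0 _ z0)) ?abs_ge0// mulr_ge0 ?abs_ge0.
apply: (@le_trans _ _ (Num.max (abs (emb a * Y)) (abs (emb c * X)) * imag z)).
  by rewrite ler_wpM2r ?absB_le// ltW.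
rewrite maxr_pMl ?(ltW z0)// ge_max !absM; apply/andP; split.
  by rewrite mulrAC ler_wpM2r ?abs_ge0// imag_linear_le.
by rewrite mulrAC mulrC ler_wpM2l ?abs_ge0// imag_linear_le.
Qed.

(** The automorphy factor j(g, z). *)
Definition autfac g z : K := emb (g i1 i0) * z + emb (g i1 i1).

Lemma autfac_neq0 g z : Omega abs emb z -> \det g != 0 -> autfac g z != 0.
Proof.
move=> Oz; rewrite det_mx2E => dg; apply: linear_neq0 => //.
by apply: contraNT dg; rewrite negb_or !negbK => /andP[/eqP-> /eqP->]; rewrite !mulr0 subrr.
Qed.

(** Given a fraction a/b, apply [imag_det_le] to the matrix whose top row is b times the top row of
    g minus a times its bottom row, and whose bottom row is that of g. Its determinant is b det g
    and its top linear form is (gz - a/b) b j(g, z); cancelling |b| bounds the distance from gz to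
    a/b. *)
Lemma imag_mob_ge g z : Omega abs emb z -> \det g != 0 ->
  abs (emb (\det g)) * imag z / abs (autfac g z) ^+ 2 <= imag (mob emb g z).
Proof.
move=> Oz dg; have j0 := autfac_neq0 Oz dg.
have ja := abs_gt0 j0; have z0 := (OmegaP z).1 Oz.
have d0 : 0 < abs (emb (\det g)) by rewrite abs_gt0// emb_eq0.
apply: imag_ge; first by rewrite divr_gt0 ?exprn_gt0// mulr_gt0.
move=> a b b0; have eb : emb b != 0 by rewrite emb_eq0.
have ba := abs_gt0 eb.
have := imag_det_le z (g i0 i0 * b - a * g i1 i0) (g i0 i1 * b - a * g i1 i1) (g i1 i0) (g i1 i1).
have -> : (g i0 i0 * b - a * g i1 i0) * g i1 i1 - (g i0 i1 * b - a * g i1 i1) * g i1 i0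
  = b * \det g by rewrite det_mx2E; ring.
rewrite -/(autfac g z).
have -> : emb (g i0 i0 * b - a * g i1 i0) * z + emb (g i0 i1 * b - a * g i1 i1) =
   (mob emb g z - emb a / emb b) * emb b * autfac g z.
  rewrite !rmorphB !rmorphM /mob -/(autfac g z).
  transitivity ((emb (g i0 i0) * z + emb (g i0 i1)) * emb b -
    emb a * (emb (g i1 i0) * z + emb (g i1 i1))); first by ring.
  by rewrite -/(autfac g z); field; rewrite ?j0 ?eb.
rewrite rmorphM !absM => H.
rewrite ler_pdivrMr ?exprn_gt0// -(ler_pM2l ba) mulrA (le_trans H)//.
by rewrite le_eqVlt; apply/orP; left; apply/eqP; ring.
Qed.

Lemma mob_Omega g z : Omega abs emb z -> \det g != 0 -> Omega abs emb (mob emb g z).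
Proof.
move=> Oz dg; apply/OmegaP; apply: lt_le_trans (imag_mob_ge Oz dg).
rewrite divr_gt0 ?exprn_gt0// ?abs_gt0 ?autfac_neq0//.
by rewrite mulr_gt0 ?abs_gt0 ?emb_eq0//; apply/OmegaP.
Qed.

(** The upper bound is the lower bound [imag_mob_ge] for the adjugate h of g at w = gz, because hw =
    z, det h = det g and j(h, w) = det g / j(g, z). *)
Lemma imag_mob g z : Omega abs emb z -> \det g != 0 ->
  imag (mob emb g z) = abs (emb (\det g)) * imag z / abs (autfac g z) ^+ 2.
Proof.
move=> Oz dg; apply/eqP; rewrite eq_le imag_mob_ge// andbT.
pose h := mx2 (g i1 i1) (- g i0 i1) (- g i1 i0) (g i0 i0).
have dh : \det h = \det g by rewrite det_mx2 det_mx2E; ring.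
have j0 := autfac_neq0 Oz dg.
have ed : emb (\det g) != 0 by rewrite emb_eq0.
have jw : autfac h (mob emb g z) = emb (\det g) / autfac g z.
  rewrite /autfac /mob -/(autfac g z) !mx2E !rmorphN det_mx2E rmorphB !rmorphM.
  by apply: (mulIf j0); rewrite mulfVK// mulrDl -mulrA mulfVK// /autfac; ring.
have mw : mob emb h (mob emb g z) = z.
  rewrite {1}/mob -/(autfac h (mob emb g z)) jw.
  rewrite /mob -/(autfac g z) !mx2E !rmorphN.
  have e : emb (g i1 i1) * ((emb (g i0 i0) * z + emb (g i0 i1)) / autfac g z) -
      emb (g i0 i1) = emb (\det g) * z / autfac g z.
    apply: (mulIf j0); rewrite mulfVK// mulrBl -mulrA mulfVK//.
    by rewrite det_mx2E rmorphB !rmorphM /autfac; ring.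
  by rewrite e; field; rewrite ed j0.
have dh0 : \det h != 0 by rewrite dh.
have := imag_mob_ge (mob_Omega Oz dg) dh0; rewrite mw dh jw absM absV.
have da := abs_gt0 ed; have ja := abs_gt0 j0.
set D := abs (emb (\det g)); set j := abs (autfac g z); set w := imag _.
rewrite ler_pdivrMr; last by rewrite exprn_gt0// divr_gt0.
rewrite ler_pdivlMr ?exprn_gt0//.
have -> : imag z * (D / j) ^+ 2 = D * (D * imag z / j ^+ 2) by field; rewrite gt_eqF.
by rewrite ler_pM2l// ler_pdivlMr ?exprn_gt0.
Qed.

Lemma autfac_mul g h z : Omega abs emb z -> \det h != 0 ->
  autfac (g *m h) z = autfac g (mob emb h z) * autfac h z.
Proof.
move=> Oz dh; have j0 := autfac_neq0 Oz dh.
rewrite {2}/autfac /mob -/(autfac h z) mulrDl -mulrA mulfVK//.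
by rewrite /autfac !mulmx2E !rmorphD !rmorphM; ring.
Qed.

(** Both sides are computed by [imag_mob] and agree by multiplicativity of the determinant and the
    cocycle relation [autfac_mul]. *)
Lemma imag_mob_mul g h z : Omega abs emb z -> \det g != 0 -> \det h != 0 ->
  imag (mob emb (g *m h) z) = imag (mob emb g (mob emb h z)).
Proof.
move=> Oz dg dh; have Ow := mob_Omega Oz dh.
have dgh : \det (g *m h) != 0 by rewrite det_mulmx mulf_neq0.
rewrite !imag_mob// autfac_mul// det_mulmx rmorphM !absM.
have jh := abs_gt0 (autfac_neq0 Oz dh); have jg := abs_gt0 (autfac_neq0 Ow dg).
by field; rewrite !gt_eqF.
Qed.

Lemma absA_unit a : a \is a GRing.unit -> absA R a = 1.
Proof.
move=> /unit_polyP[c c0 ->].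
by rewrite /absA polyC_eq0 (negPf c0) size_polyC c0 expr0.
Qed.

Lemma imag_mob_unit g z : Omega abs emb z -> GL2A g ->
  imag (mob emb g z) = imag z / abs (autfac g z) ^+ 2.
Proof. by move=> Oz Gg; rewrite imag_mob ?GL2A_det_neq0// abs_emb absA_unit// mul1r. Qed.

Lemma imag_mob_triangular g z : Omega abs emb z -> Binf g -> imag (mob emb g z) = imag z.
Proof.
move=> Oz [Gg g0]; rewrite imag_mob_unit// /autfac g0 rmorph0 mul0r add0r abs_emb.
move: Gg; rewrite /GL2A /= det_mx2E g0 mulr0 subr0 unitrM => /andP[_ /absA_unit ->].
by rewrite expr1n divr1.
Qed.

End ImaginaryPart.

(** * Convergence of power series in the degree over polynomials and pairs of them *)

Section Summability.
Variables (F : finFieldType) (R : realType).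
Local Notation q := (qF F R).
Implicit Types c d : {poly F}.

Lemma le_esum_set (T : choiceType) (S S' : set T) (a : T -> \bar R) :
  S `<=` S' -> (\esum_(t in S) a t <= \esum_(t in S') a t)%E.
Proof.
move=> SS'; apply: ge_ereal_sup => _ [X [fX XS] <-].
by apply: ereal_sup_ubound; exists X => //; split => //; apply: subset_trans SS'.
Qed.

Lemma esum_geometric_lty (M x : R) : 0 <= M -> 0 < x -> x < 1 ->
  (\esum_(k in [set: nat]) (M * x ^+ k)%:E < +oo)%E.
Proof.
move=> M0 x0 x1; have t0 k : (0 <= (M * x ^+ k)%:E)%E by rewrite lee_fin mulr_ge0 ?exprn_ge0// ltW.
rewrite -nneseries_esumT//; apply: (@le_lt_trans _ _ (M / (1 - x))%:E); last exact: ltry.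
apply: lime_le; first exact: is_cvg_nneseries.
apply: nearW => k; rewrite sumEFin lee_fin.
by apply: (geometric_le_lim k M0 x0); rewrite gtr0_norm.
Qed.

(** Coefficient vectors of length k number q^k, and polynomials of size k inject into them. *)
Lemma esum_size_eq (k : nat) (x : R) : 0 <= x ->
  (\esum_(c in [set c : {poly F} | size c = k]) x%:E <= (q ^+ k * x)%:E)%E.
Proof.
move=> x0.
have ci : set_inj [set c : {poly F} | size c = k] (@coefv F k).
  move=> c d /set_mem /= sc /set_mem /= sd e.
  by rewrite -(coefvK (m := k) (p := c)) ?sc// e coefvK// sd.
rewrite -(esum_image _ _ (fun=> x%:E) ci).
apply: (le_trans (le_esum_set _ (@subsetT _ _))).
rewrite (_ : setT = [set v | predT v]); last by apply/seteqP.
rewrite esum_pred => [|v]; last by rewrite lee_fin.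
by rewrite sumEFin sumr_const card_ffun card_ord -mulr_natl natrX.
Qed.

Lemma esum_poly_lty (r : R) : 0 < r -> q * r < 1 ->
  (\esum_(c in [set: {poly F}]) (r ^+ (size c).-1)%:E < +oo)%E.
Proof.
move=> r0 qr1; have q0 : 0 < q := lt_trans ltr01 (qF_gt1 F R).
rewrite (_ : setT = \bigcup_(k in [set: nat]) [set c : {poly F} | size c = k]); last first.
  by apply/seteqP; split => // c _; exists (size c).
rewrite esum_bigcupT; first last.
- by move=> c; rewrite lee_fin exprn_ge0// ltW.
- by move=> i j _ _ [c [/= <- <-]].
(* Size k contributes at most q^k r^(k-1), which is r^-1 (q r)^k, except that for k = 0 the
   truncated exponent gives 1. The constant 1 + r^-1 covers both cases. *)
apply: le_lt_trans (esum_geometric_lty (M := 1 + r^-1) _ (mulr_gt0 q0 r0) qr1); last first.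
  by rewrite addr_ge0 ?invr_ge0 ?ltW.
apply: le_esum => k _.
rewrite (eq_esum (b := fun _ => (r ^+ k.-1)%:E)); last by move=> c /= ->.
apply: le_trans (esum_size_eq _ _) _; first by rewrite exprn_ge0 ?ltW.
rewrite lee_fin exprMn mulrCA ler_wpM2l ?exprn_ge0 ?(ltW q0)//.
case: k => [|k] /=; first by rewrite !expr0 mulr1 lerDl invr_ge0 ltW.
by rewrite exprS mulrDl mul1r mulKf ?gt_eqF// lerDr mulr_ge0 ?exprn_ge0 ?ltW.
Qed.

Lemma esum_poly2_lty (r : R) : 0 < r -> q * r < 1 ->
  (\esum_(k in [set: {poly F} * {poly F}])
     (r ^+ (size k.1).-1 * r ^+ (size k.2).-1)%:E < +oo)%E.
Proof.
move=> r0 qr1; have W := esum_poly_lty r0 qr1.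
have w0 c : (0 <= (r ^+ (size c).-1)%:E)%E by rewrite lee_fin exprn_ge0 ?ltW.
rewrite (_ : setT = setT `*`` (fun=> setT)); last by apply/seteqP; split.
rewrite -(@esum_esum _ _ _ _ _ (fun c d => (r ^+ (size c).-1 * r ^+ (size d).-1)%:E)); last first.
  by move=> c d _ _; rewrite lee_fin mulr_ge0 ?exprn_ge0 ?ltW.
have Wf : \esum_(c in [set: {poly F}]) (r ^+ (size c).-1)%:E \is a fin_num.
  by rewrite ge0_fin_numE// esum_ge0.
rewrite (eq_esum (b := fun c => (fine (\esum_(c in [set: {poly F}]) (r ^+ (size c).-1)%:E))%:E *
    (r ^+ (size c).-1)%:E)%E); last first.
  move=> c _; rewrite fineK// muleC -esum_scale//; last by rewrite exprn_ge0 ?ltW.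
rewrite esum_scale//; last by rewrite fine_ge0// esum_ge0.
by rewrite lte_mul_pinfty// lee_fin fine_ge0// esum_ge0.
Qed.

End Summability.

(** * Absolute convergence of the Eisenstein series *)

Section Eisenstein.
Variables (F : finFieldType) (R : realType) (K : closedFieldType).
Variables (abs : K -> R) (emb : {rmorphism {poly F} -> K}).
Hypothesis cinf : is_Cinf abs emb.
Implicit Types (z : K) (c d : {poly F}) (s : R[i]).

Local Notation imag := (imag_abs abs emb).
Local Notation q := (qF F R).

(** One has |c| <= |cz + d| / |z|_i and |d| <= max(|cz + d|, |c| |z|); the constant adds up the
    factors 1, |z| / |z|_i and 1 / |z|_i that occur. *)
Lemma linear_coef_le z : Omega abs emb z -> exists2 L : R, 0 < L &
  forall c d, (c != 0) || (d != 0) ->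
    q ^+ (size c).-1 <= L * abs (emb c * z + emb d) /\
    q ^+ (size d).-1 <= L * abs (emb c * z + emb d).
Proof.
move=> Oz; have y0 := (OmegaP cinf z).1 Oz.
have az := abs_ge0 cinf z.
exists (1 + abs z / imag z + (imag z)^-1).
  by rewrite -addrA ltr_pwDl// addr_ge0 ?divr_ge0 ?invr_ge0 ?(ltW y0).
move=> c d cd; set L := _ + _; set j := abs (_ + _).
have j0 : 0 <= j by apply: abs_ge0 cinf _.
have cj := imag_linear_le cinf z c d; rewrite -/j in cj.
have yz : 0 <= abs z / imag z by rewrite divr_ge0// ltW.
have yi : 0 <= (imag z)^-1 by rewrite invr_ge0 ltW.
have cL : abs (emb c) <= L * j.
  apply: (@le_trans _ _ ((imag z)^-1 * j)); first by rewrite mulrC ler_pdivlMr.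
  by rewrite ler_wpM2r// /L lerDr addr_ge0.
have dL : abs (emb d) <= L * j.
  have : abs (emb d) <= Num.max j (abs (emb c * z)).
    have {1}-> : emb d = (emb c * z + emb d) - emb c * z by rewrite addrC addKr.
    exact: (absB_le cinf).
  rewrite le_max => /orP[dj|].
    by rewrite (le_trans dj)// -[leLHS]mul1r ler_wpM2r// /L -addrA lerDl addr_ge0.
  rewrite (absM cinf) => dcz; apply: (le_trans dcz).
  apply: (@le_trans _ _ (abs z / imag z * j)).
    rewrite mulrC -mulrA ler_wpM2l// mulrC ler_pdivlMr//.
  by rewrite ler_wpM2r// /L addrAC lerDr addr_ge0.
move: cL dL cd; rewrite !(abs_emb cinf) /absA.
(* For a zero coefficient the truncated exponent makes the power equal to 1, which is at most the
   absolute value of the other, nonzero coefficient. *)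
have [->|c0] := eqVneq c 0; have [->|d0] := eqVneq d 0.
- by [].
- move=> _ dL _; split=> //; rewrite size_poly0 expr0 (le_trans _ dL)//.
  by rewrite exprn_ege1// ltW// qF_gt1.
- move=> cL _ _; split=> //; rewrite size_poly0 expr0 (le_trans _ cL)//.
  by rewrite exprn_ege1// ltW// qF_gt1.
- by [].
Qed.

Lemma le_expR_ln (t x y : R) : 0 <= t -> 0 < x -> x <= y ->
  expR (t * ln x) <= expR (t * ln y).
Proof.
move=> t0 x0 xy; rewrite ler_expR ler_wpM2l// ler_ln ?posrE//.
exact: lt_le_trans xy.
Qed.

(** If (c, d) is the bottom row of the representative, multiplying the two bounds of
    [linear_coef_le] gives |gz|_i <= |z|_i L^2 / (q^deg c q^deg d). The t-th power is then dominated
    by a constant times a product of two geometric terms. *)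
Lemma rsummable_imag_pow z (t : R) : Omega abs emb z -> 1 < t ->
  rsummable (@cosets F) (fun C => expR (t * ln (imag (mob emb (xget 0 C) z)))).
Proof.
move=> Oz t1; have y0 := (OmegaP cinf z).1 Oz.
have [L L0 HL] := linear_coef_le Oz.
have q0 : 0 < q := lt_trans ltr01 (qF_gt1 F R).
(* This is q^-t, so q r = q^(1 - t) is below 1 because t > 1. *)
pose r := expR (- t * ln q).
have r0 : 0 < r by exact: expR_gt0.
have qr : q * r < 1.
  rewrite -{1}(lnK (x := q)) ?posrE// -expRD -[ltRHS]expR0 ltr_expR.
  have lq : 0 < ln q by rewrite ln_gt0// qF_gt1.
  by rewrite -{1}(mul1r (ln q)) -mulrDl nmulr_rlt0// subr_lt0.
pose e (C : set 'M[{poly F}]_2) := (xget 0 C i1 i0, xget 0 C i1 i1).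
have ei : set_inj (@cosets F) e.
  move=> C D /set_mem cC /set_mem cD [e0 e1].
  have [[GC <-] [GD <-]] := (xget_coset cC, xget_coset cD).
  exact: rcoset_bottom.
pose M := expR (t * ln (imag z * L ^+ 2)).
pose w (k : {poly F} * {poly F}) := r ^+ (size k.1).-1 * r ^+ (size k.2).-1.
have sw : rsummable (@cosets F) (fun C => w (e C)).
  rewrite /rsummable /summable.
  rewrite -(esum_image _ _ (fun k => `|(w k)%:E|%E) ei).
  apply: (le_lt_trans (le_esum_set _ (@subsetT _ _))).
  apply: le_lt_trans (esum_poly2_lty r0 qr); apply: le_esum => k _ /=.
  by rewrite ger0_norm// mulr_ge0 ?exprn_ge0 ?ltW.
apply: (rsummable_le (rsummableZ M sw)) => C cC.
have [GC _] := xget_coset cC.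
rewrite ger0_norm ?expR_ge0// imag_mob_unit//.
have j0 := abs_gt0 cinf (autfac_neq0 cinf Oz (GL2A_det_neq0 GC)).
have [|H0 H1] := HL (xget 0 C i1 i0) (xget 0 C i1 i1).
  apply: contraNT (GL2A_det_neq0 GC); rewrite negb_or !negbK det_mx2E.
  by move=> /andP[/eqP-> /eqP->]; rewrite !mulr0 subrr.
rewrite -/(autfac _ _ _) in H0 H1.
have -> : M * w (e C) = expR (t * ln (imag z * L ^+ 2 *
    ((q ^+ (size (e C).1).-1)^-1 * (q ^+ (size (e C).2).-1)^-1))).
  have qn k : 0 < q ^+ k by rewrite exprn_gt0.
  have qi k : 0 < (q ^+ k)^-1 by rewrite invr_gt0.
  have yL : 0 < imag z * L ^+ 2 by rewrite mulr_gt0 ?exprn_gt0.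
  rewrite lnM ?posrE ?mulr_gt0// mulrDr expRD -/M; congr (_ * _).
  rewrite lnM ?posrE// mulrDr expRD /w.
  have h k : r ^+ k = expR (t * ln (q ^+ k)^-1).
    by rewrite lnV ?posrE// lnXn// -expRM_natl mulrN mulNr mulrnAr mulr_natl mulNrn.
  by rewrite !h.
apply: le_expR_ln; first by rewrite ltW// (lt_trans ltr01).
  by rewrite divr_gt0// exprn_gt0.
rewrite -mulrA ler_pM2l// -invfM ler_pdivlMr ?mulr_gt0 ?exprn_gt0//.
rewrite mulrC ler_pdivrMr ?exprn_gt0// -exprMn expr2.
by rewrite ler_pM// exprn_ge0// ltW.
Qed.

Lemma csummable_eisenstein z s : Omega abs emb z -> 1 < complex.Re s ->
  csummable (@cosets F) (fun C => cpow (imag (mob emb (xget 0 C) z)) s).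
Proof.
move=> Oz s1; have H := rsummable_imag_pow Oz s1.
split; apply: (rsummable_le H) => C _; rewrite /cpow /= mul0r ?subr0 ?addr0 normrM;
  rewrite ger0_norm ?expR_ge0//; apply: ler_piMr; rewrite ?expR_ge0 ?cos_max ?sin_max//.
Qed.

End Eisenstein.

(** * Complex powers of positive reals *)

Section ComplexPowers.
Variable R : realType.
Implicit Types (x y : R) (s t : R[i]).

Lemma cpowM x y s : 0 < x -> 0 < y -> cpow (x * y) s = cpow x s * cpow y s.
Proof.
move=> x0 y0; rewrite /cpow lnM ?posrE// !mulrDr expRD cosD sinD.
by apply/eqP; rewrite eq_complex /=; apply/andP; split; apply/eqP; ring.
Qed.

Lemma cpowD x s t : cpow x (s + t) = cpow x s * cpow x t.
Proof.
case: s t => [s s'] [t t']; rewrite /cpow /= !mulrDl expRD cosD sinD.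
by apply/eqP; rewrite eq_complex /=; apply/andP; split; apply/eqP; ring.
Qed.

Lemma cpow_1 x : 0 < x -> cpow x 1 = (x%:C)%C.
Proof.
move=> x0; rewrite /cpow /= mul1r mul0r lnK ?posrE// cos0 sin0.
by apply/eqP; rewrite eq_complex /= !(mulr0, mul0r, mulr1, subr0, addr0) !eqxx.
Qed.

(* Multiplying by |d|^(2s) and then by |d|^(1-2s) avoids any division. *)
Lemma cpow_divisor x y s : 0 < x -> 0 < y ->
  cpow (x / y ^+ 2) s * (y%:C)%C = cpow x s * cpow y (1 - 2%:R * s).
Proof.
move=> x0 y0; have y2 : 0 < y ^+ 2 by rewrite exprn_gt0.
have -> : (y%:C)%C = cpow y (s + s) * cpow y (1 - 2%:R * s).
  by rewrite -cpowD -cpow_1//; congr cpow; ring.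
have {2}-> : x = x / y ^+ 2 * (y * y) by rewrite -expr2 mulfVK// gt_eqF.
by rewrite !cpowM ?mulr_gt0 ?invr_gt0// cpowD mulrA.
Qed.

End ComplexPowers.

(** * The involution a -> n / a on monic divisors *)

Section Divisors.
Variables (F : finFieldType) (n : {poly F}).
Hypothesis n_monic : n \is monic.

Let divisor (t : {ffun 'I_(size n) -> F}) := (polyv t \is monic) && (polyv t %| n).

Lemma divp_monic_divisor a : a \is monic -> a %| n ->
  [/\ n %/ a \is monic, n %/ a %| n & n %/ (n %/ a) = a].
Proof.
move=> am an; have nE : n = a * (n %/ a) by rewrite mulrC divpK.
have dm : n %/ a \is monic by move: n_monic; rewrite {1}nE monicMl.
split => //; first by rewrite {2}nE dvdp_mull.
by rewrite {1}nE mulpK// monic_neq0.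
Qed.

Lemma divp_divisor (t : {ffun 'I_(size n) -> F}) : divisor t ->
  [/\ n %/ polyv t \is monic, n %/ polyv t %| n & n %/ (n %/ polyv t) = polyv t].
Proof. by move=> /andP[tm tn]; apply: divp_monic_divisor. Qed.

(** Reindex by the involution a -> n / a, read on coefficient vectors. It reconciles the Hecke sum,
    whose factors depend on d = n / a, with [sigmaA]. *)
Lemma sum_divisor_compl (V : nmodType) (G : {poly F} -> V) :
  \sum_(t | divisor t) G (n %/ polyv t) = \sum_(t | divisor t) G (polyv t).
Proof.
have n0 : n != 0 by rewrite monic_neq0.
pose c (t : {ffun 'I_(size n) -> F}) := coefv (size n) (n %/ polyv t).
have cE t : divisor t -> polyv (c t) = n %/ polyv t.
  by move=> /divp_divisor[_ dn _]; rewrite coefvK// dvdp_leq.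
have cd t : divisor t -> divisor (c t).
  by move=> dt; rewrite /divisor cE//; have [-> ->] := divp_divisor dt.
have cK t : divisor t -> c (c t) = t.
  move=> dt; apply: polyv_inj; rewrite cE ?cd// cE//.
  by have [_ _] := divp_divisor dt.
rewrite [RHS](reindex_onto c c) => [|t]; last exact: cK.
apply: eq_big => [t|t dt]; last by rewrite cE.
by apply/idP/andP => [dt|[/cd + /eqP e]]; rewrite ?e// cd// cK.
Qed.

End Divisors.

(** * Evaluating the sum over the cosets of determinant n in two ways *)

Section Hecke.
Variables (F : finFieldType) (R : realType) (K : closedFieldType).
Variables (abs : K -> R) (emb : {rmorphism {poly F} -> K}).
Hypothesis cinf : is_Cinf abs emb.
Variables (n : {poly F}) (z : K) (s : R[i]).
Hypotheses (n_monic : n \is monic) (Oz : Omega abs emb z) (s_gt1 : 1 < complex.Re s).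

Local Notation imag := (imag_abs abs emb).
Local Notation term := (fun C => cpow (imag (mob emb (xget 0 C) z)) s).

(** The chosen representative is u g with u in B, and B preserves |.|_i. A summand may thus be
    evaluated at any matrix of its coset. *)
Lemma imag_rcoset g : \det g != 0 ->
  imag (mob emb (xget 0 (rcoset g)) z) = imag (mob emb g z).
Proof.
move=> dg; have : rcoset g (xget 0 (rcoset g)).
  by apply: xgetPex; exists g; exists 1%:M; [exact: Binf1|rewrite mul1mx].
move=> [u Bu <-]; rewrite (imag_mob_mul cinf)//; last by case: Bu => /GL2A_det_neq0.
by rewrite (imag_mob_triangular cinf)//; apply: mob_Omega.
Qed.

Let n0 : n != 0. Proof. by rewrite monic_neq0. Qed.

Lemma det_hermite_neq0 (j : hermite_index n) : hermite_valid j -> \det (hermite_mx j) != 0.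
Proof. by move=> vj; rewrite det_hermite_mx. Qed.

Lemma term_left (j : hermite_index n) C : hermite_valid j -> cosets C ->
  term (rcoset (xget 0 C *m hermite_mx j)) =
  cpow (imag (mob emb (xget 0 C) (mob emb (hermite_mx j) z))) s.
Proof.
move=> vj cC; have dj := det_hermite_neq0 vj.
have dC := GL2A_det_neq0 (xget_coset cC).1.
by rewrite imag_rcoset ?det_mulmx ?mulf_neq0// (imag_mob_mul cinf).
Qed.

(** The bottom row of M is (0 d), so j(M, w) = d for every w, and the factor (|n| / |d|^2)^s is the
    same for all cosets. *)
Lemma term_right (j : hermite_index n) C : hermite_valid j -> cosets C ->
  term (rcoset (hermite_mx j *m xget 0 C)) =
  cpow (absA R n / absA R (n %/ polyv (tag j)) ^+ 2) s * term C.
Proof.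
move=> vj cC; have dj := det_hermite_neq0 vj.
have dC := GL2A_det_neq0 (xget_coset cC).1.
rewrite imag_rcoset ?det_mulmx ?mulf_neq0// (imag_mob_mul cinf)//.
have Ow := mob_Omega cinf Oz dC.
rewrite (imag_mob cinf)// det_hermite_mx// /autfac !mx2E rmorph0 mul0r add0r !(abs_emb cinf).
have d0 : n %/ polyv (tag j) != 0.
  by apply: contraNneq dj => d0; rewrite det_mx2 mulr0 subr0 d0 mulr0.
have p0 : 0 < absA R n / absA R (n %/ polyv (tag j)) ^+ 2.
  by rewrite divr_gt0 ?exprn_gt0// absA_gt0.
by rewrite mulrAC (cpowM _ p0)//; apply/(OmegaP cinf).
Qed.

Lemma hecke_csum : hecke emb (fun w => Eis abs emb w s) n z = csum (det_cosets n) term.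
Proof.
rewrite (csum_partition (det_cosets_bijl n0)); last first.
  move=> j vj; apply: csummable_eq (fun C cC => term_left vj cC).
  by apply: csummable_eisenstein => //; apply: mob_Omega => //; apply: det_hermite_neq0.
(* The nested sums over a and b become one sum over Hermite forms, each acting by z -> (az + b) /
   d. *)
rewrite /hecke sig_big_dep; apply: eq_big => [j|j /andP[vj _]].
  by rewrite andbT.
rewrite (_ : _ / _ = mob emb (hermite_mx j) z); last first.
  by rewrite /mob !mx2E rmorph0 mul0r add0r.
by rewrite /Eis; apply: csum_eq => C cC; rewrite (term_left vj cC).
Qed.

Lemma csum_det_cosets : csum (det_cosets n) term =
  cpow (absA R n) s * sigmaA (1 - 2%:R * s) n * Eis abs emb z s.
Proof.
have sE := csummable_eisenstein cinf Oz s_gt1.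
rewrite (csum_partition (det_cosets_bijr n0)); last first.
  move=> j vj; exact: csummable_eq (csummableZ _ sE) (fun C cC => term_right vj cC).
pose k (d : {poly F}) := cpow (absA R n / absA R d ^+ 2) s.
rewrite (eq_bigr (fun j => k (n %/ polyv (tag j)) * Eis abs emb z s)); last first.
  by move=> j vj; rewrite (csum_eq (fun C cC => term_right vj cC)) csumZ.
rewrite -mulr_suml; congr (_ * _).
transitivity (\sum_(t : {ffun 'I_(size n) -> F} | (polyv t \is monic) && (polyv t %| n))
    \sum_(v : {ffun 'I_(size (n %/ polyv t)).-1 -> F}) k (n %/ polyv t)).
  by rewrite sig_big_dep; apply: eq_bigl => j; rewrite andbT.
rewrite /sigmaA mulr_sumr.
rewrite -(sum_divisor_compl n_monic (fun d => cpow (absA R n) s * cpow (absA R d) (1 - 2 * s))).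
apply: eq_bigr => t /(divp_divisor n_monic)[dm _ _].
have d0 := monic_neq0 dm.
(* The summand depends on d alone, and the number of residues b is q^deg d = |d|; [cpow_divisor]
   absorbs this factor. *)
rewrite -cpow_divisor ?absA_gt0// sumr_const card_ffun card_ord -mulr_natr; congr (_ * _).
by rewrite /absA (negPf d0) /qF -natrX rmorph_nat.
Qed.

End Hecke.

Theorem theorem6p5 (F : finFieldType) (R : realType) (K : closedFieldType)
  (abs : K -> R) (emb : {rmorphism {poly F} -> K}) :
  odd #|F| -> is_Cinf abs emb ->
  forall n : {poly F}, n \is monic ->
  forall z : K, Omega abs emb z ->
  forall s : R[i], 1 < complex.Re s ->
  hecke emb (fun w => Eis abs emb w s) n z =
    cpow (absA R n) s * sigmaA (1 - 2%:R * s) n * Eis abs emb z s.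
Proof.
move=> _ cinf n n_monic z Oz s s_gt1.
by rewrite (hecke_csum cinf)// (csum_det_cosets cinf).
Qed.
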